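(* Let $(R,\mathfrak{m})$ be a complete Noetherian local commutative ring of prime characteristic $p$ that is $F$-finite. Let $M$ be a right $R[x,f]$-module that is Noetherian as an $R$-module. Then there exists a non-negative integer $e$ such that $Mx^e = Mx^{e+1}$, that is, such that $M\,R[x,f]x^e = M\,R[x,f]x^{e+1}$.
   Context: $f : R \to R$, $f(r)=r^p$, is the Frobenius homomorphism; $R$ is $F$-finite if $f$ is a finite ring homomorphism. The Frobenius skew polynomial ring $R[x,f]$ is freely generated as a left $R$-module by $(x^i)_{i\ge 0}$, with multiplication subject to $xr = r^p x$ for $r\in R$. A right $R[x,f]$-module is regarded as an $R$-module by restriction of scalars. For $t\ge 0$, $R[x,f]x^t=\bigoplus_{i\ge t}Rx^i$ is a graded two-sided ideal of $R[x,f]$, and $Mx^t := \{mx^t : m\in M\} = M\,R[x,f]x^t$, which is an $R[x,f]$-submodule of $M$. *)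

(* Defs.v *)
From HB Require Import structures.
From mathcomp Require Import all_boot all_order all_algebra.
From mathcomp Require Import boolp classical_sets.
Set Implicit Arguments.
Unset Strict Implicit.
Unset Printing Implicit Defensive.
Import GRing.Theory.
Local Open Scope classical_set_scope.
Local Open Scope ring_scope.

(* Skew polynomials sum_i r_i x^i over R, with coefficients on the left and
   x r = f(r) x.  They have the same underlying additive group as {poly R}. *)
Definition skewpoly (R : nzRingType) (f : {rmorphism R -> R}) : Type :=
  {poly R}.

Section SkewPolyRing.
Variables (R : nzRingType) (f : {rmorphism R -> R}).
Local Notation S := (skewpoly f).

HB.instance Definition _ := GRing.Zmodule.copy S {poly R}.

Definition skew_coef (P : S) (i : nat) : R := (P : {poly R})`_i.
Definition skewC (r : R) : S := r%:P.
Definition skewX : S := 'X.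

(* (r x^j) (s x^k) = r f^j(s) x^(j+k) *)
Definition skew_mul (P Q : S) : S :=
  \poly_(i < size (P : {poly R}) + size (Q : {poly R}))
    \sum_(j < i.+1) skew_coef P j * iter j f (skew_coef Q (i - j)).

Lemma iterf0 n : iter n f 0 = 0.
Proof. by elim: n => //= n ->; rewrite rmorph0. Qed.

Lemma iterf1 n : iter n f 1 = 1.
Proof. by elim: n => //= n ->; rewrite rmorph1. Qed.

Lemma iterfD n x y : iter n f (x + y) = iter n f x + iter n f y.
Proof. by elim: n => //= n ->; rewrite rmorphD. Qed.

Lemma iterfM n x y : iter n f (x * y) = iter n f x * iter n f y.
Proof. by elim: n => //= n ->; rewrite rmorphM. Qed.

Lemma iterf_sum n (I : Type) (r : seq I) (P : pred I) (F : I -> R) :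
  iter n f (\sum_(i <- r | P i) F i) = \sum_(i <- r | P i) iter n f (F i).
Proof. exact: (big_morph _ (iterfD n) (iterf0 n)). Qed.

Lemma skew_coefP (P Q : S) : (forall i, skew_coef P i = skew_coef Q i) -> P = Q.
Proof. by move=> h; apply/polyP. Qed.

Lemma skew_coefD (P Q : S) i :
  skew_coef (P + Q) i = skew_coef P i + skew_coef Q i.
Proof. exact: coefD. Qed.

Lemma skew_coefC r i : skew_coef (skewC r) i = if i == 0%N then r else 0.
Proof. exact: coefC. Qed.

Lemma skew_coefX i : skew_coef skewX i = (i == 1%N)%:R.
Proof. exact: coefX. Qed.

Lemma skew_coef_mul (P Q : S) i : skew_coef (skew_mul P Q) i =
  \sum_(j < i.+1) skew_coef P j * iter j f (skew_coef Q (i - j)).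
Proof.
rewrite {1}/skew_coef coef_poly; case: ltnP => // le_i.
rewrite big1 // => j _; have [ltP|leP] := ltnP j (size (P : {poly R})).
  rewrite [skew_coef Q _]nth_default ?iterf0 ?mulr0 //.
  rewrite leq_subRL; last by rewrite -ltnS.
  by rewrite (leq_trans _ le_i) // leq_add2r ltnW.
by rewrite [skew_coef P _]nth_default ?mul0r.
Qed.

Lemma skew_coef_mul_rev (P Q : S) i : skew_coef (skew_mul P Q) i =
  \sum_(j < i.+1) skew_coef P (i - j) * iter (i - j) f (skew_coef Q j).
Proof.
rewrite skew_coef_mul (reindex_inj rev_ord_inj) /=.
by apply: eq_bigr => j _; rewrite (sub_ordK j).
Qed.

Fact skew_mulA : associative skew_mul.
Proof.
move=> p q r; apply: skew_coefP => i; rewrite skew_coef_mul skew_coef_mul_rev.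
pose coef3 j k := skew_coef p j * (iter j f (skew_coef q (i - j - k))
   * iter (i - k) f (skew_coef r k)).
transitivity (\sum_(j < i.+1) \sum_(k < i.+1 | (k <= i - j)%N) coef3 j k).
  apply: eq_bigr => /= j _.
  rewrite skew_coef_mul_rev iterf_sum big_distrr /=.
  rewrite (big_ord_narrow_leq (leq_subr _ _)); apply: eq_bigr => k _ /=.
  rewrite /coef3 iterfM -iterD; congr (_ * (_ * iter _ f _)).
  have le_j : (j <= i)%N by rewrite -ltnS.
  have le_k : (k <= i - j)%N by rewrite -ltnS.
  by rewrite addnBA // subnKC.
rewrite (exchange_big_dep predT) //=; apply: eq_bigr => k _.
transitivity (\sum_(j < i.+1 | (j <= i - k)%N) coef3 j k).
  apply: eq_bigl => j; rewrite -ltnS -(ltnS j) -!subSn ?leq_ord //.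
  by rewrite -subn_gt0 -(subn_gt0 j) -!subnDA addnC.
rewrite (big_ord_narrow_leq (leq_subr _ _)) skew_coef_mul big_distrl /=.
by apply: eq_bigr => j _; rewrite /coef3 -!subnDA addnC mulrA.
Qed.

Fact skew_mul1l : left_id (skewC 1) skew_mul.
Proof.
move=> p; apply: skew_coefP => i; rewrite skew_coef_mul big_ord_recl subn0.
by rewrite big1 => [|j _]; rewrite skew_coefC /= ?mul0r ?mul1r ?addr0.
Qed.

Fact skew_mul1r : right_id (skewC 1) skew_mul.
Proof.
move=> p; apply: skew_coefP => i; rewrite skew_coef_mul_rev big_ord_recl subn0.
by rewrite big1 => [|j _];
  rewrite skew_coefC /= ?iterf0 ?iterf1 ?mulr0 ?mulr1 ?addr0.
Qed.

Fact skew_mulDl : left_distributive skew_mul +%R.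
Proof.
move=> p q r; apply: skew_coefP => i.
rewrite skew_coefD !skew_coef_mul -big_split.
by apply: eq_bigr => j _; rewrite skew_coefD mulrDl.
Qed.

Fact skew_mulDr : right_distributive skew_mul +%R.
Proof.
move=> p q r; apply: skew_coefP => i.
rewrite skew_coefD !skew_coef_mul -big_split.
by apply: eq_bigr => j _; rewrite skew_coefD iterfD mulrDr.
Qed.

Fact skew_oner_neq0 : skewC 1 != 0.
Proof. exact: (oner_neq0 {poly R}). Qed.

HB.instance Definition _ := GRing.Zmodule_isNzRing.Build S
  skew_mulA skew_mul1l skew_mul1r skew_mulDl skew_mulDr skew_oner_neq0.

Lemma skew_coefM (P Q : S) i : skew_coef (P * Q) i =
  \sum_(j < i.+1) skew_coef P j * iter j f (skew_coef Q (i - j)).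
Proof. exact: skew_coef_mul. Qed.

Lemma skewCM r s : skewC (r * s) = skewC r * skewC s.
Proof.
apply: skew_coefP => i; rewrite skew_coefM big_ord_recl big1 => [|j _].
  by rewrite addr0 subn0 !skew_coefC /=; case: eqP; rewrite ?mulr0.
by rewrite skew_coefC /= mul0r.
Qed.

Lemma skewXC r : skewX * skewC r = skewC (f r) * skewX.
Proof.
apply: skew_coefP => i; rewrite !skew_coefM.
rewrite [RHS]big_ord_recl [X in _ = _ + X]big1 => [|j _]; last by rewrite skew_coefC /= mul0r.
rewrite addr0 subn0 skew_coefC skew_coefX /=.
case: i => [|i].
  by rewrite big_ord1 skew_coefX mul0r mulr0.
rewrite 2!big_ord_recl big1 => [|j _]; last by rewrite skew_coefX /= mul0r.
rewrite !skew_coefX /= mul0r mul1r add0r addr0 /bump /= subn1 /=.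
by case: i => [|i]; rewrite !skew_coefC /= ?mulr1 ?mulr0 ?rmorph0.
Qed.

Lemma skew_expansion (P : S) :
  P = \sum_(i < size (P : {poly R})) skewC (skew_coef P i) * skewX ^+ i.
Proof.
have coefXn n i : skew_coef (skewX ^+ n) i = (i == n)%:R.
  elim: n i => [|n IH] i.
    by rewrite expr0 [LHS]skew_coefC; case: eqP.
  rewrite exprS skew_coefM; case: i => [|i].
    by rewrite big_ord1 skew_coefX mul0r.
  rewrite 2!big_ord_recl big1 => [|j _]; last by rewrite skew_coefX /= mul0r.
  rewrite !skew_coefX /= mul0r mul1r add0r addr0 /bump /= subn1 /= IH eqSS.
  by case: eqP => _; rewrite ?rmorph1 ?rmorph0.
have coefCM r (Q : S) i : skew_coef (skewC r * Q) i = r * skew_coef Q i.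
  rewrite skew_coefM big_ord_recl big1 => [|j _]; last first.
    by rewrite skew_coefC /= mul0r.
  by rewrite skew_coefC subn0 addr0.
have coef_sum n (F : 'I_n -> S) i :
    skew_coef (\sum_(k < n) F k) i = \sum_(k < n) skew_coef (F k) i.
  by apply: (big_morph (fun Q : S => skew_coef Q i)) => [a b|];
    [exact: skew_coefD | exact: coef0].
apply: skew_coefP => i; rewrite coef_sum.
have [lt_i|le_i] := ltnP i (size (P : {poly R})).
  rewrite (bigD1 (Ordinal lt_i)) //= coefCM coefXn eqxx mulr1 big1 ?addr0 //.
  by move=> k /eqP ne; rewrite coefCM coefXn; case: eqP => [e|_];
    [case: ne; apply: val_inj | rewrite mulr0].
rewrite [LHS]nth_default // big1 // => k _; rewrite coefCM coefXn.
by case: eqP => [e|_]; [move: (ltn_ord k); rewrite -e ltnNge le_i | rewrite mulr0].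
Qed.

End SkewPolyRing.

(* A right A-module is a left module over the converse ring A^c. *)
Definition ract (A : nzRingType) (M : lmodType A^c) (m : M) (a : A) : M :=
  (a : A^c) *: m.

Lemma ractA (A : nzRingType) (M : lmodType A^c) (m : M) (a b : A) :
  ract (ract m a) b = ract m (a * b).
Proof. exact: scalerA. Qed.

(* For R commutative, r |-> r x^0 is also a morphism into R[x,f]^c; right
   R[x,f]-modules are restricted to R along it. *)
Definition skewCc (R : comNzRingType) (f : {rmorphism R -> R}) (r : R) :
  (skewpoly f)^c := skewC f r.

Section SkewCc.
Variables (R : comNzRingType) (f : {rmorphism R -> R}).

Fact skewCc_zmod_morphism : zmod_morphism (@skewCc R f).
Proof. by move=> r s; exact: polyCB. Qed.

Fact skewCc_monoid_morphism : monoid_morphism (@skewCc R f).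
Proof. by split=> // r s; rewrite mulrC; exact: skewCM. Qed.

HB.instance Definition _ := GRing.isZmodMorphism.Build R (skewpoly f)^c
  (@skewCc R f) skewCc_zmod_morphism.
HB.instance Definition _ := GRing.isMonoidMorphism.Build R (skewpoly f)^c
  (@skewCc R f) skewCc_monoid_morphism.

End SkewCc.

Definition restrict_scalars (A B : nzRingType) (phi : {rmorphism A -> B})
  (M : lmodType B) : Type := M.

Section RestrictScalars.
Variables (A B : nzRingType) (phi : {rmorphism A -> B}) (M : lmodType B).
Local Notation N := (restrict_scalars phi M).

HB.instance Definition _ := GRing.Zmodule.copy N M.

Definition restr_scale (a : A) (m : N) : N := phi a *: (m : M).

Fact restr_scalerA a b m :
  restr_scale a (restr_scale b m) = restr_scale (a * b) m.
Proof. by rewrite /restr_scale scalerA rmorphM. Qed.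

Fact restr_scale1r : left_id 1 restr_scale.
Proof. by move=> m; rewrite /restr_scale rmorph1 scale1r. Qed.

Fact restr_scalerDr : right_distributive restr_scale +%R.
Proof. by move=> a m n; exact: scalerDr. Qed.

Fact restr_scalerDl m : {morph restr_scale^~ m : a b / a + b}.
Proof. by move=> a b; rewrite /restr_scale rmorphD; exact: scalerDl. Qed.

HB.instance Definition _ := GRing.Zmodule_isLmodule.Build A N
  restr_scalerA restr_scale1r restr_scalerDr restr_scalerDl.

End RestrictScalars.

Definition submodule (A : nzRingType) (M : lmodType A) (N : set M) : Prop :=
  submod_closed (mem N).

Definition finitely_generated (A : nzRingType) (M : lmodType A) (N : set M) :
    Prop :=
  exists n (g : 'I_n -> M),
    N = [set v | exists c : 'I_n -> A, v = \sum_i c i *: g i].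

Definition noetherian_module (A : nzRingType) (M : lmodType A) : Prop :=
  forall N : set M, submodule N -> finitely_generated N.

Section CommutativeAlgebra.
Variable R : comNzRingType.

Definition is_ideal (I : set R) : Prop := submodule (I : set R^o).

Definition noetherian_ring : Prop := noetherian_module R^o.

Definition maximal_ideal (I : set R) : Prop :=
  [/\ is_ideal I, I <> setT &
      forall J : set R, is_ideal J -> I `<=` J -> J = I \/ J = setT].

Definition local_ring (m : set R) : Prop :=
  maximal_ideal m /\ forall I : set R, maximal_ideal I -> I = m.

Definition ideal_mul (I J : set R) : set R :=
  [set r | exists n (a b : 'I_n -> R),
    [/\ forall i, I (a i), forall i, J (b i) & r = \sum_i a i * b i]].

Definition ideal_exp (I : set R) (n : nat) : set R := iter n (ideal_mul I) setT.

(* I-adically complete, separatedness included *)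
Definition adically_complete (I : set R) : Prop :=
  (\bigcap_n ideal_exp I n = [set 0]) /\
  forall u : nat -> R,
    (forall n, exists N, forall i j, (N <= i)%N -> (N <= j)%N ->
      ideal_exp I n (u i - u j)) ->
    exists l : R, forall n, exists N, forall i, (N <= i)%N ->
      ideal_exp I n (u i - l).

End CommutativeAlgebra.

(* B is a finitely generated A-module through phi *)
Definition finite_rmorphism (A B : nzRingType) (phi : {rmorphism A -> B}) :
    Prop :=
  finitely_generated [set: restrict_scalars phi B^o].

Definition F_finite (p : nat) (R : comNzRingType) (chRp : p \in [pchar R]) :
    Prop :=
  finite_rmorphism (pFrobenius_aut chRp).

Section RightModule.
Variables (R : nzRingType) (f : {rmorphism R -> R}).
Variable M : lmodType (skewpoly f)^c.

Definition skewX_ideal (t : nat) : set (skewpoly f) :=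
  [set P * skewX f ^+ t | P in [set: skewpoly f]].

(* M J, the subgroup of M generated by all products m a with a in J *)
Definition ract_ideal (J : set (skewpoly f)) : set M :=
  [set v | exists n (m : 'I_n -> M) (a : 'I_n -> skewpoly f),
    (forall i, J (a i)) /\ v = \sum_i ract (m i) (a i)].

Definition ract_Xn (t : nat) : set M :=
  [set ract m (skewX f ^+ t) | m in [set: M]].

Lemma ract_XnE t : ract_Xn t = ract_ideal (skewX_ideal t).
Proof.
apply/seteqP; split=> [_ [m _ <-]|_ [n [m [a [Ja ->]]]]].
  exists 1%N, (fun=> m), (fun=> skewX f ^+ t); split.
    by move=> _; exists 1; rewrite ?mul1r.
  by rewrite big_ord1.
have /choice[b bE] : forall i, exists P, P * skewX f ^+ t = a i.
  by move=> i; have [P _ <-] := Ja i; exists P.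
exists (\sum_i ract (m i) (b i)) => //.
rewrite /ract scaler_sumr; apply: eq_bigr => i _.
by rewrite -bE; exact: ractA.
Qed.

End RightModule.

Arguments ract_ideal {R f} M J.
Arguments ract_Xn {R f} M t.
Arguments skewX_ideal {R} f t.

(* Main.v *)
Require Import Defs.
From HB Require Import structures.
From mathcomp Require Import all_boot all_order all_algebra.
From mathcomp Require Import boolp classical_sets.
Import GRing.Theory.
Local Open Scope classical_set_scope.
Local Open Scope ring_scope.

(** This is Gabber's argument, with localization at a prime replaced by
    multiplication by elements outside it.  Let [k] be the right action of
    [x], so that [r k(v) = k(r^p v)].  The images [M_n = k^n(M)] form a
    descending chain of submodules, and the ideals [I_n = (M_{n+1} : M_n)]
    ascend, hence are equal to some [I] for [n >= N].  Since [r^p M_n] in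
    [M_{n+1}] implies [r M_{n+1}] in [M_{n+2}], the ideal [I] is radical;
    and if [a] is in [I] then [a^2 M_N] lies in every [M_n], because
    [a^2 M_N <= a k(M_N) = k(a^p M_N) <= k(a^2 M_N)].  If [I] were proper, let
    [P = (I : s)] be maximal among the ideals [(I : s')] with [s'] not in
    [I].  Then [P] is prime, contains [I], and does not contain [s], and
    [s^2 y^2 M_N] lies in every [M_n] for [y] in [P].  So, locally at [P],
    the module [M_N / \bigcap_n M_n] has finite length and the chain becomes
    stationary: [t M_n] is in [M_{n+1}] for some [t] outside [P] and some
    [n >= N].  Then [t] is in [I], a contradiction. *)

(** * Submodules and the Noetherian chain conditions *)

Section Submodules.
Variables (A : nzRingType) (V : lmodType A).
Implicit Type N : set V.

Lemma submoduleP N :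
  submodule N <-> N 0 /\ forall a u v, N u -> N v -> N (a *: u + v).
Proof.
split=> [[N0 NZD]|[N0 NZD]].
  split=> [|a u v Nu Nv]; first by rewrite -in_setE.
  by rewrite -in_setE; apply: NZD; rewrite in_setE.
split=> [|a u v]; rewrite !in_setE //; exact: NZD.
Qed.

Lemma submodule0 N : submodule N -> N 0.
Proof. by case/submoduleP. Qed.

Lemma submoduleD N u v : submodule N -> N u -> N v -> N (u + v).
Proof. by move/submoduleP=> [_ NZD] Nu Nv; rewrite -[u]scale1r; apply: NZD. Qed.

Lemma submoduleZ N a u : submodule N -> N u -> N (a *: u).
Proof.
by move/submoduleP=> [N0 NZD] Nu; rewrite -[_ *: _]addr0; apply: NZD.
Qed.

Lemma submoduleB N u v : submodule N -> N u -> N v -> N (u - v).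
Proof.
by move=> sN Nu Nv; apply: submoduleD => //; rewrite -scaleN1r; apply: submoduleZ.
Qed.

Lemma submodule_sum N n (F : 'I_n -> V) :
  submodule N -> (forall i, N (F i)) -> N (\sum_i F i).
Proof.
move=> sN NF; apply: (big_ind N) => // [|u v].
  exact: submodule0.
exact: submoduleD.
Qed.

Lemma chain_submodule_bigcup (F : nat -> set V) :
  (forall n, submodule (F n)) ->
  (forall m n, (m <= n)%N -> F m `<=` F n) -> submodule (\bigcup_n F n).
Proof.
move=> sF Fmono; apply/submoduleP; split.
  by exists 0%N => //; exact: submodule0.
move=> a u v [i _ Fu] [j _ Fv]; exists (maxn i j) => //.
apply: submoduleD => //; last exact: Fmono (leq_maxr _ _) _ Fv.
by apply: submoduleZ => //; exact: Fmono (leq_maxl _ _) _ Fu.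
Qed.

(** The union is finitely generated, and the term with the largest index among those chosen for the
    generators already contains all of them. *)
Lemma noetherian_ascending_chain (F : nat -> set V) : noetherian_module V ->
  (forall n, submodule (F n)) ->
  (forall m n, (m <= n)%N -> F m `<=` F n) -> exists n, F n.+1 `<=` F n.
Proof.
move=> noethV sF Fmono.
have [n [g Eg]] := noethV _ (chain_submodule_bigcup _ sF Fmono).
have Fg i : exists j, F j (g i).
  suff [j _ Fj] : (\bigcup_k F k) (g i) by exists j.
  rewrite Eg; exists (fun j => (j == i)%:R).
  rewrite (bigD1 i) //= eqxx scale1r big1 ?addr0 // => j /negbTE ->.
  by rewrite scale0r.
have /choice[h Fh] := Fg.
exists (\max_i h i) => v Fv.
have : (\bigcup_k F k) v by exists (\max_i h i).+1.
rewrite Eg => -[c ->]; apply: submodule_sum => // i; apply: submoduleZ => //.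
by apply: (Fmono _ _ _ _ (Fh i)); exact: leq_bigmax.
Qed.

(** Otherwise choice would build a strictly ascending chain. The family is indexed so that a maximal
    submodule comes with the vector or multiplier that defines it. *)
Lemma noetherian_maximal (J : Type) (Q : J -> Prop) (F : J -> set V) (j0 : J) :
  noetherian_module V -> (forall j, Q j -> submodule (F j)) -> Q j0 ->
  exists j, Q j /\ forall j', Q j' -> F j `<=` F j' -> F j' `<=` F j.
Proof.
move=> noethV sF Qj0; apply: contrapT => nomax.
have step (j : {j | Q j}) : exists j' : {j | Q j},
    F (sval j) `<=` F (sval j') /\ ~ (F (sval j') `<=` F (sval j)).
  case: j => j Qj /=; apply: contrapT => nostep; apply: nomax.
  exists j; split=> // j' Qj' le_jj'; apply: contrapT => nle.
  by apply: nostep; exists (exist _ j' Qj').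
have /choice[h hP] := step.
pose c n := iter n h (exist _ j0 Qj0).
have cmono m n : (m <= n)%N -> F (sval (c m)) `<=` F (sval (c n)).
  move/subnK <-; elim: (n - m)%N => [|d IH] //.
  by rewrite addSn; apply: subset_trans IH _; exact: (hP _).1.
have [n] := noetherian_ascending_chain (fun n => F (sval (c n))) noethV
  (fun n => sF _ (svalP (c n))) cmono.
exact: (hP (c n)).2.
Qed.

End Submodules.

(** * Chains of submodules up to multipliers in a multiplicative set [T] *)

Section CommutativeSubmodules.
Variables (R : comNzRingType) (V : lmodType R).

Lemma colon_submodule (N : set V) v :
  submodule N -> submodule ([set r | N (r *: v)] : set R^o).
Proof.
move=> sN; apply/submoduleP; split=> [|a r r' Nr Nr'] /=.
  by rewrite scale0r; exact: submodule0.
by rewrite scalerDl -scalerA; apply: submoduleD => //; apply: submoduleZ.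
Qed.

Lemma preimage_scale_submodule (N : set V) (t : R) :
  submodule N -> submodule [set v | N (t *: v)].
Proof.
move=> sN; apply/submoduleP; split=> [|a u v Nu Nv] /=.
  by rewrite scaler0; exact: submodule0.
rewrite scalerDr scalerA mulrC -scalerA.
by apply: submoduleD => //; apply: submoduleZ.
Qed.

Lemma submodule_add_line (N : set V) v :
  submodule N -> submodule [set w | exists r, N (w - r *: v)].
Proof.
move=> sN; apply/submoduleP; split=> [|a u w [r Nr] [r' Nr']] /=.
  by exists 0; rewrite scale0r subr0; exact: submodule0.
exists (a * r + r'); rewrite scalerDl -scalerA opprD addrACA -scalerBr.
by apply: submoduleD => //; apply: submoduleZ.
Qed.

Hypotheses (noethR : noetherian_ring R) (noethV : noetherian_module V).
Variables (T : set R) (L : nat -> set V) (s : R).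
Hypotheses (T1 : T 1) (TM : forall t u, T t -> T u -> T (t * u)) (Ts : T s).
Hypotheses (sL : forall n, submodule (L n))
  (Ldec : forall n, L n.+1 `<=` L n).

Lemma le_chain m n : (m <= n)%N -> L n `<=` L m.
Proof.
by move/subnK <-; elim: (n - m)%N => [|d IH] // v /Ldec /IH.
Qed.

(* A simple submodule of [L 0 / B] locally at [T]; maximality of [(B : v)]
   replaces the choice of an associated prime. *)
Lemma generic_socle_element (B : set V) : submodule B ->
  (forall y v, ~ T y -> L 0%N v -> B (s *: (y ^+ 2 *: v))) ->
  (exists v, L 0%N v /\ forall t, T t -> ~ B (t *: v)) ->
  exists v, [/\ L 0%N v, forall t, T t -> ~ B (t *: v) &
                forall y, ~ T y -> B (y *: v)].
Proof.
move=> sB killB [v0 v0P].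
have [] := @noetherian_maximal R R^o V
  (fun v => L 0%N v /\ forall t, T t -> ~ B (t *: v))
  (fun v => [set r | B (r *: v)]) v0 noethR (fun v _ => colon_submodule _ v sB)
  v0P.
move=> v [[Lv Bv] vmax]; exists v; split=> // y nTy; apply: contrapT => nByv.
(* Maximality gives [(B : t v) = (B : v)]. If no element of [T] takes [y v] into [B], the same holds
   for [y v], so [s y^2 v] in [B] forces [y v] in [B]. *)
have scaleT t r : T t -> B (r *: (t *: v)) -> B (r *: v).
  move=> Tt; apply: vmax => [|q /= Bq].
    split=> [|u Tu]; first exact: submoduleZ.
    by rewrite scalerA; apply: Bv; exact: TM.
  by rewrite scalerA mulrC -scalerA; apply: submoduleZ.
have /= scaley r : B (r *: (y *: v)) -> B (r *: v).
  apply: vmax => [|q /= Bq].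
    split=> [|t Tt Btyv]; first exact: submoduleZ.
    by apply: nByv; apply: (scaleT t) => //; rewrite scalerA mulrC -scalerA.
  by rewrite scalerA mulrC -scalerA; apply: submoduleZ.
apply: nByv; apply: scaley; rewrite scalerA; apply: (scaleT s) => //.
by rewrite scalerA mulrC -scalerA -expr2; apply: killB.
Qed.

(** For [t] with [(B : t)] maximal, a further factor [u] in [T] cannot enlarge it, so this one [t]
    serves every vector. *)
Lemma generic_bound (B : set V) : submodule B ->
  (forall v, L 0%N v -> exists t, T t /\ B (t *: v)) ->
  exists t, T t /\ forall v, L 0%N v -> B (t *: v).
Proof.
move=> sB LB.
have [] := @noetherian_maximal R V R T (fun t => [set v | B (t *: v)]) 1
  noethV (fun t _ => preimage_scale_submodule _ t sB) T1.
move=> t [Tt tmax]; exists t; split=> // v /LB[u [Tu Bu]].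
apply: (tmax (t * u)) => [|w /= Bw|/=]; first exact: TM.
  by rewrite mulrC -scalerA; apply: submoduleZ.
by rewrite -scalerA; apply: submoduleZ.
Qed.

(** Noetherian induction replaces induction on length: a maximal [C] above [B] where the conclusion
    fails is enlarged by a generically simple line, and the conclusion for the larger submodule is
    brought back to [C]. *)
Lemma generically_stationary (B : set V) : submodule B ->
  (forall y v, ~ T y -> L 0%N v -> B (s *: (y ^+ 2 *: v))) ->
  exists N, forall n, (N <= n)%N ->
    exists t, T t /\ forall v, L n v -> exists w, L n.+1 w /\ B (t *: v - w).
Proof.
pose D (C : set V) := exists N, forall n, (N <= n)%N ->
  exists t, T t /\ forall v, L n v -> exists w, L n.+1 w /\ C (t *: v - w).
move=> sB0 killB0; apply: contrapT => nD0.
have [] := @noetherian_maximal R V (set V)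
  (fun C => [/\ submodule C, B `<=` C & ~ D C]) id B noethV _
  (And3 sB0 (fun x Bx => Bx) nD0).
  by move=> C [].
move=> C [[sC leBC nDC] Cmax]; apply: nDC.
have [/(generic_socle_element C sC)|nov] :=
  pselect (exists v, L 0%N v /\ forall t, T t -> ~ C (t *: v)); last first.
  have [|t [Tt tC]] := generic_bound C sC.
    move=> v Lv; apply: contrapT => not; apply: nov; exists v; split=> // t Tt Ct.
    by apply: not; exists t.
  exists 0%N => n _; exists t; split=> // v Lv; exists 0.
  split; first exact: submodule0.
  by rewrite subr0; apply: tC; exact: le_chain Lv.
case=> [y v nTy Lv|g [Lg Cg Pg]]; first by apply: leBC; exact: killB0.
pose C' := [set w | exists r, C (w - r *: g)].
have leCC' : C `<=` C' by move=> w Cw; exists 0; rewrite scale0r subr0.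
have [N1 DN1] : D C'.
  apply: contrapT => nDC'; apply: (Cg 1 T1); rewrite scale1r.
  apply: (Cmax C'); last by exists 1; rewrite scale1r subrr; exact: submodule0.
    by split=> //; [exact: submodule_add_line | exact: subset_trans leCC'].
  exact: leCC'.
(* It remains to treat the part of [L n] inside [C']: the error [t1 v - w1] lies there, and the two
   multipliers compose. *)
suff [N2 DN2] : exists N2, forall n, (N2 <= n)%N -> exists t, T t /\
    forall v, L n v -> C' v -> exists w, L n.+1 w /\ C (t *: v - w).
  exists (maxn N1 N2) => n; rewrite geq_max => /andP[/DN1[t1 [Tt1 H1]]].
  move=> /DN2[t2 [Tt2 H2]]; exists (t2 * t1); split; first exact: TM.
  move=> v Lv; have [w1 [Lw1 C'w1]] := H1 v Lv.
  have [|w2 [Lw2 Cw2]] := H2 (t1 *: v - w1) _ C'w1.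
    apply: submoduleB => //; [exact: submoduleZ | exact: Ldec].
  exists (t2 *: w1 + w2); split.
    by apply: submoduleD => //; exact: submoduleZ.
  by rewrite opprD addrA -scalerA -scalerBr.
(* [C' / C] is generically simple. Either every [L n] generically fills it, and [r] carries
   [u = c g] to [c v] modulo [C] with [v] in [L n.+1]; or from some [N] on, [L n] meets [C'] only
   inside [C]. *)
have [allT|] := pselect (forall n, exists v r, [/\ L n v, T r & C (v - r *: g)]).
  exists 0%N => n _; have [v [r [Lv Tr Cv]]] := allT n.+1.
  exists r; split=> // u _ [c Cu]; exists (c *: v).
  split; first exact: submoduleZ.
  rewrite (_ : _ - _ = r *: (u - c *: g) - c *: (v - r *: g)).
    by apply: submoduleB => //; apply: submoduleZ.
  by rewrite !scalerBr !scalerA (mulrC c r) opprB addrA subrK.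
move=> /existsNP[N noT]; exists N => n leNn; exists 1; split=> // v Lv [r Cv].
exists 0; split; first exact: submodule0.
rewrite scale1r subr0 -(subrK (r *: g) v); apply: submoduleD => //; apply: Pg.
by move=> Tr; apply: noT; exists v, r; split=> //; exact: le_chain Lv.
Qed.

End CommutativeSubmodules.

(** * Images of the iterates of an additive map with [r k(v) = k(r^p v)] *)

Section InverseFrobeniusLinear.
Variables (R : comNzRingType) (V : lmodType R) (p : nat) (k : {additive V -> V}).
Hypotheses (noethR : noetherian_ring R) (noethV : noetherian_module V).
Hypotheses (p_gt1 : (1 < p)%N) (kZ : forall r v, r *: k v = k (r ^+ p *: v)).

Let im n : set V := range (iter n k).
Let I n : set R := [set r | forall v, im n v -> im n.+1 (r *: v)].

Lemma image_iterS n v : im n v -> im n.+1 (k v).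
Proof. by move=> [u _ <-]; exists u. Qed.

Lemma image_iterSP n v : im n.+1 v -> exists2 u, im n u & v = k u.
Proof. by move=> [u _ <-]; exists (iter n k u) => //; exists u. Qed.

Lemma image_iter_submodule n : submodule (im n).
Proof.
elim: n => [|n IH]; apply/submoduleP.
  by split=> [|a u v _ _]; [exists 0 | exists (a *: u + v)].
split=> [|a u v].
  by rewrite -(raddf0 k); apply: image_iterS; exact: submodule0.
move=> /image_iterSP[u' Mu ->] /image_iterSP[v' Mv ->].
rewrite kZ -raddfD; apply: image_iterS.
by apply: submoduleD => //; apply: submoduleZ.
Qed.

Lemma image_iter_dec n : im n.+1 `<=` im n.
Proof. by move=> _ [u _ <-]; exists (k u) => //; rewrite -iterSr. Qed.

Lemma colon_image_submodule n : submodule (I n : set R^o).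
Proof.
have sM := image_iter_submodule.
apply/submoduleP; split=> [v _|a r r' Ir Ir' v Mv].
  by rewrite scale0r; exact: submodule0.
rewrite scalerDl -scalerA; apply: submoduleD => //; last exact: Ir'.
by apply: submoduleZ => //; exact: Ir.
Qed.

Lemma colon_image_expp n r : I n (r ^+ p) -> I n.+1 r.
Proof.
move=> Ir _ /image_iterSP[u Mu ->]; rewrite kZ; apply: image_iterS; exact: Ir.
Qed.

Lemma colon_imageM n a r : I n r -> I n (a * r).
Proof. exact: submoduleZ (colon_image_submodule n). Qed.

Lemma colon_image_sqr n r : I n (r ^+ 2) -> I n.+1 r.
Proof.
by move=> Ir; apply: colon_image_expp; rewrite -(subnK p_gt1) exprD; exact: colon_imageM.
Qed.

Lemma colon_image_inc n : I n `<=` I n.+1.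
Proof. by move=> r Ir; apply: colon_image_sqr; apply: colon_imageM. Qed.

Lemma colon_image_inc_le m n : (m <= n)%N -> I m `<=` I n.
Proof.
by move/subnK <-; elim: (n - m)%N => [|d IH] // r /IH /colon_image_inc.
Qed.

Lemma sqr_colon_image m n r v : I m r -> im m v -> im (n + m) (r ^+ 2 *: v).
Proof.
(* A factor [r^2] is kept inside [k^n]: one [r] turns [w] into some [k u], the other enters [k] as
   [r^p = r^2 r^(p-2)]. *)
move=> Ir Mv; suff [w Mw ->] :
    exists2 w, im m w & r ^+ 2 *: v = iter n k (r ^+ 2 *: w).
  have : im m (r ^+ 2 *: w) by apply: submoduleZ (image_iter_submodule m) _.
  by move=> [u _ <-]; exists u => //; rewrite iterD.
elim: n => [|n [w Mw ->]]; first by exists v.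
have [u Mu Eu] := image_iterSP _ _ (Ir w Mw).
exists (r ^+ (p - 2) *: u); first exact: submoduleZ (image_iter_submodule m) _.
by rewrite expr2 -scalerA Eu kZ -iterSr /= scalerA -expr2 -exprD subnKC.
Qed.

Theorem image_iter_stationary : exists e, im e = im e.+1.
Proof.
have [N [_ Nmax]] := @noetherian_maximal R R^o nat (fun=> True) I 0%N noethR
  (fun n _ => colon_image_submodule n) Logic.I.
have I_const n : (N <= n)%N -> I n `<=` I N.
  by move=> leNn; apply: Nmax => //; exact: colon_image_inc_le.
have [I1|nI1] := pselect (I N 1).
  exists N; apply/seteqP; split; last exact: image_iter_dec.
  by move=> v /I1; rewrite scale1r.
have I_radical r : I N (r ^+ 2) -> I N r.
  by move=> /colon_image_sqr; apply: I_const.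
have [] := @noetherian_maximal R R^o R (fun s => ~ I N s)
  (fun s => [set r | I N (r * s)]) 1 noethR
  (fun s _ => @colon_submodule R R^o _ s (colon_image_submodule N)) nI1.
move=> s [nIs smax].
pose T := [set t | ~ I N (t * s)].
(* Primality of [(I : s)]: for [t] in [T], maximality gives [(I : t s) = (I : s)]. *)
have TM t u : T t -> T u -> T (t * u).
  move=> Tt Tu Itu; apply: Tu; apply: (smax (t * s)) => //= [r Ir|].
    by rewrite /= mulrCA; exact: colon_imageM.
  by rewrite mulrCA mulrA.
have T1 : T 1 by rewrite /T /= mul1r.
have Ts : T s by move=> /= Iss; apply: nIs; apply: I_radical; rewrite expr2.
pose L n := im (n + N).
have sL n : submodule (L n) := image_iter_submodule _.
have Ldec n : L n.+1 `<=` L n by exact: image_iter_dec.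
have sB : submodule (\bigcap_n L n).
  apply/submoduleP; split=> [n _|a u v Lu Lv n _]; first exact: submodule0.
  by apply: submoduleD => //; [apply: submoduleZ => //; exact: Lu | exact: Lv].
have killB y v : ~ T y -> L 0%N v -> (\bigcap_n L n) (s ^+ 2 *: (y ^+ 2 *: v)).
  move=> /contrapT Iys Lv n _; rewrite scalerA -exprMn mulrC.
  exact: sqr_colon_image.
(* The correction [t v - w] lies in every [L n], in particular in [L n0.+1]; hence [t] is in
   [I (n0 + N)], so in [I N], and then so is [t s], against [T t]. *)
have [n0 /(_ _ (leqnn n0))[t [Tt tL]]] := generically_stationary _ _
  noethR noethV T L (s ^+ 2) T1 TM (TM _ _ Ts Ts) sL Ldec _ sB killB.
case: Tt; rewrite mulrC; apply: colon_imageM.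
apply: (I_const (n0 + N)%N); first exact: leq_addl.
move=> v /tL[w [Lw Bw]]; rewrite -(subrK w (t *: v)).
by apply: (submoduleD _ _ _ _ _ (sL n0.+1)) => //; exact: Bw.
Qed.

End InverseFrobeniusLinear.

(** * Application to the right action of [x] *)

Theorem theorem3p1 (p : nat) (R : comNzRingType) (m : set R)
  (chRp : p \in [pchar R])
  (noethR : noetherian_ring R) (localR : local_ring m)
  (completeR : adically_complete m) (FfinR : F_finite chRp)
  (M : lmodType (skewpoly (pFrobenius_aut chRp))^c)
  (noethM : noetherian_module
              (restrict_scalars (@skewCc R (pFrobenius_aut chRp)) M)) :
  exists e : nat,
    ract_Xn M e = ract_Xn M e.+1 /\
    ract_ideal M (skewX_ideal (pFrobenius_aut chRp) e) =
      ract_ideal M (skewX_ideal (pFrobenius_aut chRp) e.+1).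
Proof.
pose F := pFrobenius_aut chRp.
pose V := restrict_scalars (@skewCc R F) M.
pose k (v : V) : V := ract (v : M) (skewX F).
have kB : zmod_morphism k by move=> u v; exact: (scalerBr (V := M)).
pose kA := GRing.isZmodMorphism.Build V V k kB.
pose kadd : {additive V -> V} := HB.pack k kA.
have scaleE (r : R) (v : V) : r *: v = ract (v : M) (skewC F r) by [].
(* For a right action this is the relation [x r = r^p x]: [(v x) r = (v r^p) x]. *)
have kZ (r : R) (v : V) : r *: kadd v = kadd (r ^+ p *: v).
  rewrite -(pFrobenius_autE chRp r : F r = _) scaleE /= /k scaleE.
  by rewrite [LHS]ractA skewXC -ractA.
have ractXn e : ract_Xn M e = range (iter e kadd).
  rewrite /ract_Xn; congr image; apply/funext => v.
  elim: e => [|e IH]; first by rewrite expr0; exact: scale1r.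
  by rewrite exprSr -ractA IH.
have [e Ee] := image_iter_stationary _ _ _ kadd noethR noethM
  (prime_gt1 (pcharf_prime chRp)) kZ.
by exists e; rewrite -!ract_XnE !ractXn.
Qed.
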